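(* Let $K$ be a field, let $I$ be a square-free monomial ideal of $S=K[x_1,\ldots,x_n]$, let $\Gamma=\mathcal{N}(I)$ be its Stanley-Reisner complex, and let $E\subseteq[n]$ with $|E|=d$. (a) If $E$ is a free face of $\Gamma$, then for every $i$ $$\beta_{i,i+j}(I+(\mathbf{x}_E))=\beta_{i,i+j}(I)\quad\text{for all } j\neq d,\,d+1.$$ Moreover, if $a>2$ is an integer such that $E$ is not a facet of $\Gamma_W$ for every $W\subseteq[n]$ with $|W|=a$, then $\beta_{i,i+j}(I+(\mathbf{x}_E))=\beta_{i,i+j}(I)$ for all $i$ and all $j>2$ such that $i+j=a$. (b) (Here $d\ge 1$.) Suppose that $E$ is a free face of $\Gamma$ or of $\Delta_d(\Gamma)$, that $$d+1\geq\max\{\deg u: u \text{ a minimal monomial generator of } I\},$$ and that $A\subseteq[n]\setminus E$ is such that $E\cup\{m\}\in\Gamma$ for all $m\in A$. Then for every $i$ $$\beta_{i,i+j}\bigl(I+(x_m\mathbf{x}_E : m\in A)\bigr)=\beta_{i,i+j}(I)\quad\text{for all } j\neq d+1.$$ Moreover, if $I$ is minimally generated by monomials of degree $d+1$, and $a>2$ is an integer such that $E$ is not a facet of $\bigl(\mathcal{N}(I+(x_m\mathbf{x}_E: m\in A))\bigr)_W$ for every $W\subseteq[n]$ with $|W|=a$, then $$\beta_{i,i+j}(I+(\mathbf{x}_E))=\beta_{i,i+j}\bigl(I+(x_m\mathbf{x}_E: m\in A)\bigr)=\beta_{i,i+j}(I)$$ for all $i$ and all $j>2$ such that $i+j=a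$.
   Context: A simplicial complex on $[n]=\{1,\dots,n\}$ is a set $\Gamma$ of subsets of $[n]$ (faces) closed under taking subsets; $\dim F=|F|-1$; facets are maximal faces. For $W\subseteq[n]$, $\Gamma_W=\{F\in\Gamma: F\subseteq W\}$. A face is free if it is contained in a unique facet (facets are free). For $F\subseteq[n]$, $\mathbf{x}_F=\prod_{i\in F}x_i$. The Stanley-Reisner complex of a square-free monomial ideal $I$ of $S$ is $\mathcal{N}(I)=\{F\subseteq[n]:\mathbf{x}_F\notin I\}$. For $d\ge1$, the $d$-closure $\Delta_d(\Gamma)$ is the simplicial complex on $[n]$ such that: its $d$-dimensional faces are exactly the $d$-dimensional faces of $\Gamma$; all subsets of $[n]$ with at most $d$ elements are faces; a subset of $[n]$ with more than $d+1$ elements is a face iff all its $(d+1)$-element subsets are faces of $\Gamma$. For a graded ideal $J\subseteq S$, $\beta_{i,j}(J)=\dim_K\mathrm{Tor}_i^S(K,J)_j$ (Betti numbers of the ideal $J$ as an $S$-module). *)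

(* Defs.v *)
From mathcomp Require Import all_boot all_order all_algebra.
From mathcomp Require Import boolp.
From mathcomp Require Import mpoly.

Set Implicit Arguments.
Unset Strict Implicit.
Unset Printing Implicit Defensive.

Import GRing.Theory.

Local Open Scope ring_scope.

Section Complexes.
Variable n : nat.
Implicit Types (Gamma : {set {set 'I_n}}) (F W : {set 'I_n}).

Definition facet Gamma F : bool := maxset [pred G in Gamma] F.

Definition free_face Gamma F : bool :=
  (F \in Gamma) && (#|[set G | facet Gamma G & F \subset G]| == 1%N).

Definition restr Gamma W : {set {set 'I_n}} := [set F in Gamma | F \subset W].

(* The d-dimensional faces are those with d+1 elements; a set F with exactly
   d+1 elements is its own only (d+1)-element subset. *)
Definition d_closure (d : nat) Gamma : {set {set 'I_n}} :=
  [set F : {set 'I_n} | (#|F| <= d)%N ||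
     [forall G : {set 'I_n},
        (G \subset F) && (#|G| == d.+1) ==> (G \in Gamma)]].

End Complexes.

Section Ideals.
Variables (K : fieldType) (n : nat).
Local Notation S := {mpoly K[n]}.
Implicit Types (P I J : S -> Prop).

Definition ideal_gen P : S -> Prop := fun f =>
  exists (k : nat) (c g : 'I_k -> S),
    (forall i, P (g i)) /\ f = \sum_(i < k) c i * g i.

Definition ideal_add I J : S -> Prop := fun f =>
  exists g h, [/\ I g, J h & f = g + h].

Definition sqfree (F : {set 'I_n}) : S := \prod_(i in F) 'X_i.

Definition sqfree_monomial_ideal I : Prop :=
  exists Gs : {set {set 'I_n}},
    forall f, I f <-> ideal_gen (fun g => exists2 F, F \in Gs & g = sqfree F) f.

Definition SR_complex I : {set {set 'I_n}} :=
  [set F : {set 'I_n} | `[< ~ I (sqfree F) >]].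

(* The unique minimal set of monomial generators of a monomial ideal consists
   of its monomials that are minimal for divisibility. *)
Definition min_mono_gen I (m : 'X_{1..n}) : Prop :=
  I 'X_[m] /\ forall m' : 'X_{1..n}, (m' <= m)%MM -> I 'X_[m'] -> m' = m.

End Ideals.

Section Dimension.
Variables (K : fieldType) (V : lmodType K).
Implicit Types Z B : V -> Prop.

(* [dim_quot Z B b]: Z modulo B has a basis with b elements, for linear
   subspaces B of Z in a possibly infinite-dimensional space V. *)
Definition dim_quot Z B (b : nat) : Prop :=
  exists v : 'I_b -> V,
    [/\ forall l, Z (v l),
        forall c : 'I_b -> K, B (\sum_l c l *: v l) -> forall l, c l = 0
      & forall z, Z z -> exists c : 'I_b -> K, B (z - \sum_l c l *: v l)].

End Dimension.

Section Betti.
Variables (K : fieldType) (n : nat).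
Local Notation S := {mpoly K[n]}.
Implicit Types (J : S -> Prop) (f g : {ffun {set 'I_n} -> S}) (F G : {set 'I_n}).

(* The Koszul complex of x_0, ..., x_(n-1) is a graded free resolution of the
   S-module K (see [koszul_exact] and [koszul_augmentation]).  Its i-th module
   has the basis e_F, F a set of i variables, with e_F in degree i; tensoring
   it over S with an ideal J gives the families f of elements of J indexed by
   these F.  Families are extended by 0 to all sets F. *)
Definition koszul_chain J (i j : nat) f : Prop :=
  forall F, f F != 0 ->
    [/\ #|F| = i, (i <= j)%N, J (f F) & f F \is (j - i).-homog].

(* e_F is sent to the sum over k in F of
   (-1)^(number of elements of F smaller than k) x_k e_(F - k). *)
Definition koszul_d f : {ffun {set 'I_n} -> S} :=
  [ffun G : {set 'I_n} => \sum_(k < n | k \notin G)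
     (-1) ^+ #|[set l in G | (l < k)%N]| * 'X_k * f (k |: G)].

Definition tor_cycle J i j f : Prop :=
  koszul_chain J i j f /\ koszul_d f = 0.

Definition tor_boundary J i j f : Prop :=
  exists2 g, koszul_chain J i.+1 j g & f = koszul_d g.

(* dim_K Tor_i^S(K, J)_j; it is finite, a chain having finitely many homogeneous
   entries of fixed degree, so the default value is not used for ideals J. *)
Definition betti J (i j : nat) : nat :=
  if pselect (exists b, dim_quot (tor_cycle J i j) (tor_boundary J i j) b)
    is left e then sval (cid e) else 0%N.

End Betti.

Section KoszulResolution.
Variables (K : fieldType) (n : nat).
Local Notation S := {mpoly K[n]}.
Implicit Types (f g : {ffun {set 'I_n} -> S}) (F G : {set 'I_n}).
Implicit Types (k l t : 'I_n) (m : 'X_{1..n}).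

Local Notation below G k := #|[set l in G | (l < k)%N]|.

Let belowU1 G (k t : 'I_n) :
  t \notin G -> below (t |: G) k = ((t < k)%N + below G k)%N.
Proof.
move=> tG; have [tk|tk] := boolP (t < k)%N.
  rewrite -[RHS](_ : #|t |: [set l in G | (l < k)%N]| = _).
    by apply: eq_card => l; rewrite !inE; case: eqP => [->|]; rewrite ?tk.
  by rewrite cardsU1 inE (negbTE tG).
apply: eq_card => l; rewrite !inE; case: eqP => [->|//].
by rewrite (negbTE tk) !andbF.
Qed.

Lemma koszul_dK f : koszul_d (koszul_d f) = 0.
Proof.
apply/ffunP => G; rewrite !ffunE.
pose a k l : S := (-1) ^+ below G k * (-1) ^+ below (k |: G) l
  * ('X_k * 'X_l) * f (l |: (k |: G)).
pose A := \sum_(k | k \notin G) \sum_(l | l \notin G) (if (k < l)%N then a k l else 0).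
pose B := \sum_(k | k \notin G) \sum_(l | l \notin G) (if (l < k)%N then a k l else 0).
have -> : \sum_(k | k \notin G)
    (-1) ^+ below G k * 'X_k * koszul_d f (k |: G) = A + B.
  rewrite /A /B -big_split; apply: eq_bigr => k kG /=.
  rewrite -big_split ffunE mulr_sumr /=.
  have -> : \sum_(l | l \notin k |: G) (-1) ^+ below G k * 'X_k *
      ((-1) ^+ below (k |: G) l * 'X_l * f (l |: (k |: G)))
      = \sum_(l | l \notin G) (if l != k then a k l else 0).
    rewrite -big_mkcondr /=; apply: eq_big => [l|l _].
      by rewrite !inE negb_or andbC.
    by rewrite /a !mulrA; congr (_ * _ * _); rewrite -!mulrA; congr (_ * _);
       rewrite mulrC.
  apply: eq_bigr => l _; rewrite -(inj_eq val_inj) /=.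
  by case: (ltngtP l k); rewrite ?addr0 ?add0r.
rewrite /A exchange_big /= -big_split big1 //= => k kG.
rewrite -big_split big1 //= => l lG; case: ifP => [lk|_]; last by rewrite addr0.
rewrite /a !belowU1 // lk ltnNge (ltnW lk) /= setUCA ['X_l * _]mulrC.
rewrite add0n add1n exprS mulN1r mulrN.
rewrite [(-1) ^+ below G l * (-1) ^+ below G k]mulrC.
by rewrite -!mulrDl ?addrN ?addNr !mul0r.
Qed.

Let low k G m := [forall l : 'I_n, (l < k)%N ==> (l \notin G) && (m l == 0%N)].

(* Contracting homotopy in multidegrees different from 0: if x_k is the smallest
   variable dividing x^m x_F, then x^m e_F goes to x^m / x_k e_(F + k) when k is
   not in F, and to 0 when k is in F. *)
Let hom f : {ffun {set 'I_n} -> S} :=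
  [ffun G : {set 'I_n} => \sum_(k in G) \sum_(m <- msupp (f (G :\ k)) |
     (m k != 0%N) && low k (G :\ k) m) (f (G :\ k))@_m *: 'X_[m - U_(k)]].

Let low_sub k G m : k \in G -> low k (G :\ k) (m + U_(k))%MM = low k G m.
Proof.
move=> kG; apply: eq_forallb => l; apply: implyb_id2l => lk.
have nlk : l != k by rewrite -(inj_eq val_inj) /= ltn_eqF.
by rewrite !inE nlk mnmDE mnm1E [k == l]eq_sym (negbTE nlk) addn0.
Qed.

Let homE f G m :
  (hom f G)@_m = \sum_(k in G | low k G m) (f (G :\ k))@_(m + U_(k)).
Proof.
rewrite ffunE raddf_sum /= [RHS]big_mkcondr /=; apply: eq_bigr => k kG.
rewrite raddf_sum /= -low_sub //.
under eq_bigr do rewrite mcoeffZ mcoeffX.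
have eqm m' : m' k != 0%N -> ((m' - U_(k))%MM == m) = (m' == (m + U_(k))%MM).
  by move=> h; rewrite -[in RHS](@submK _ U_(k) m') ?lep1mP // eqm_add2r.
have [ms|ms] := boolP ((m + U_(k))%MM \in msupp (f (G :\ k))).
  rewrite big_mkcond (bigD1_seq _ ms (msupp_uniq _)) /= big1 ?addr0 => [|m' nm].
    rewrite mnmDE mnm1E eqxx addn1 /=.
    by rewrite addmK eqxx mulr1.
  by case: ifP => // /andP[h _]; rewrite eqm // (negbTE nm) mulr0.
rewrite big_seq_cond big1 ?(memN_msupp_eq0 ms) ?if_same // => m'.
case/and3P=> m's h _; rewrite eqm //; case: eqP => [e|]; last by rewrite mulr0.
by rewrite -e m's in ms.
Qed.

Let hom_pivot f G m k : low k G m -> (k \in G) || (m k != 0%N) ->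
  (hom f G)@_m = if k \in G then (f (G :\ k))@_(m + U_(k)) else 0.
Proof.
move=> lowk piv; rewrite homE.
have uniqk l : l \in G -> low l G m -> l = k.
  move=> lG lowl; apply/val_inj; case: (ltngtP l k) => //= lk.
    by move/forallP/(_ l): lowk; rewrite lk lG.
  move/forallP/(_ k): lowl; rewrite lk /= => /andP[kG /eqP mk].
  by rewrite (negbTE kG) mk eqxx in piv.
case: ifP => kG.
  rewrite (bigD1 k) /= ?kG // big1 ?addr0 // => l /andP[/andP[lG lowl] nlk].
  by rewrite (uniqk l) ?eqxx in nlk.
by rewrite big1 // => l /andP[lG lowl]; rewrite -(uniqk l) ?lG in kG.
Qed.

Let dE f G m : (koszul_d f G)@_m = \sum_(t | t \notin G)
  (if m t != 0%N then (-1) ^+ below G t * (f (t |: G))@_(m - U_(t)) else 0).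
Proof.
rewrite ffunE raddf_sum /=; apply: eq_bigr => t _.
have -> : (-1) ^+ below G t = ((-1) ^+ below G t)%:MP_[n] :> S.
  by rewrite rmorphXn rmorphN1.
rewrite -mulrA mcoeffCM; case: ifP => mt.
  congr (_ * _); rewrite -[in LHS](@submK _ U_(t) m) ?lep1mP //.
  by rewrite addmC mulrC mcoeffMX.
have -> : ('X_t * f (t |: G))@_m = 0; last by rewrite mulr0.
apply/eqP; rewrite mcoeff_eq0; apply/negP => /msuppM_le/allpairsP[[m1 m2]] /=.
rewrite msuppX inE => -[/eqP-> _ e]; move: mt; rewrite e mnmDE mnm1E eqxx.
by rewrite add1n.
Qed.

Let homotopy f F m : koszul_d f = 0 -> (F != set0) || (m != 0%MM) ->
  (koszul_d (hom f) F)@_m = (f F)@_m.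
Proof.
move=> df0 ne.
have [k0 k0P] : exists k : 'I_n, (k \in F) || (m k != 0%N).
  case/orP: ne => [/set0Pn[k kF]|nm]; first by exists k; rewrite kF.
  apply/existsP; apply: contraNT nm => /existsPn h; apply/eqP/mnmP => k.
  by rewrite mnm0E; move: (h k); rewrite negb_or negbK => /andP[_ /eqP].
case: (@arg_minnP _ k0 (fun k => (k \in F) || (m k != 0%N)) val k0P) => k kP kmin {k0 k0P}.
have lowP G m' : (forall l, (l < k)%N -> (l \in G) || (m' l != 0%N) ->
    (l \in F) || (m l != 0%N)) -> low k G m'.
  move=> h; apply/forallP => l; apply/implyP => lk.
  rewrite -[_ && _]negbK negb_and !negbK; apply/negP => /(h _ lk)/kmin.
  by rewrite leqNgt lk.
have kltF l : l \in F -> l != k -> (k < l)%N.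
  move=> lF nlk; rewrite ltn_neqAle kmin ?lF // andbT.
  by rewrite eq_sym.
have kltm l : m l != 0%N -> l != k -> (k < l)%N.
  move=> lF nlk; rewrite ltn_neqAle kmin ?lF ?orbT // andbT.
  by rewrite eq_sym.
have piv t : t \notin F -> m t != 0%N ->
  (hom f (t |: F))@_(m - U_(t)) =
    if k \in t |: F then (f ((t |: F) :\ k))@_(m - U_(t) + U_(k)) else 0.
  move=> tF mt; apply: hom_pivot.
    apply: lowP => l lk; rewrite !inE mnmBE mnm1E => /orP[/orP[/eqP->|->]|] //.
      by rewrite mt orbT.
    by move=> h; apply/orP; right; apply: contraNN h => /eqP->.
  rewrite !inE mnmBE mnm1E; have [//|ntk] := eqVneq t k.
  by rewrite subn0 kP.
rewrite dE; have [kF|kF] := boolP (k \in F); last first.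
  have mk : m k != 0%N by move: kP; rewrite (negbTE kF).
  rewrite (bigD1 k) //= mk piv // setU11 setU1K // submK ?lep1mP //.
  have -> : below F k = 0%N.
    apply: eq_card0 => l; rewrite !inE; apply/negP => /andP[lF lk].
    by move: (kmin l); rewrite lF leqNgt lk => /(_ isT).
  rewrite expr0 mul1r big1 ?addr0 // => t /andP[tF ntk]; case: ifP => // mt.
  by rewrite piv // !inE eq_sym (negbTE ntk) (negbTE kF) mulr0.
have := dE f (F :\ k) (m + U_(k)).
rewrite df0 ffunE mcoeff0 (bigD1 k) ?setD11 //= mnmDE mnm1E eqxx addn1 /=.
rewrite addmK setD1K //.
have -> : below (F :\ k) k = 0%N.
  apply: eq_card0 => l; rewrite !inE; apply/negP => /andP[/andP[nlk lF] lk].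
  by move: (kltF l lF nlk); rewrite ltnNge (ltnW lk).
rewrite expr0 mul1r => /esym/eqP; rewrite addr_eq0 => /eqP->; rewrite -sumrN.
apply: eq_big => [t|t tF].
  by rewrite !inE; have [->|] := eqVneq t k; rewrite ?kF //= andbT.
have ntk : t != k by apply: contraNneq tF => ->.
rewrite mnmDE mnm1E [k == t]eq_sym (negbTE ntk) addn0; case: ifP => mt; last by rewrite oppr0.
rewrite piv // !inE kF orbT.
have -> : (m - U_(t) + U_(k))%MM = (m + U_(k) - U_(t))%MM.
  apply/mnmP => l; rewrite !(mnmDE, mnmBE, mnm1E).
  by have [<-|] := eqVneq t l; rewrite ?subn0 // addnBAC // lt0n.
have -> : (t |: F) :\ k = t |: (F :\ k).
  by apply/setP => l; rewrite !inE; have [->|] := eqVneq l t; rewrite ?ntk.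
rewrite -[in below F t](setD1K kF) belowU1 ?setD11 // kltm //.
by rewrite add1n exprS mulN1r mulNr.
Qed.

Let hom_chain f i j : koszul_chain (fun=> True) i j f ->
  koszul_chain (fun=> True) i.+1 j (hom f).
Proof.
move=> fc F hF.
have ex m : (hom f F)@_m != 0 ->
    exists k, [/\ k \in F, #|F :\ k| = i, (i <= j)%N & (mdeg m).+1 = (j - i)%N].
  rewrite homE => nz; have [k /andP[kF _] fk] : exists2 k,
      (k \in F) && low k F m & (f (F :\ k))@_(m + U_(k)) != 0.
    apply: contrapT => h; case/eqP: nz; rewrite big1 // => k kP.
    by apply: contrapT => /eqP fk; apply: h; exists k.
  have fn : f (F :\ k) != 0 by apply: contraNneq fk => ->; rewrite mcoeff0.
  have [c ij _ hg] := fc _ fn; exists k; split=> //.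
  rewrite -mcoeff_msupp in fk; move/dhomogP: hg => /(_ _ fk) <-.
  by rewrite -[RHS]/(mdeg (m + U_(k))) mdegD mdeg1 addn1.
have [m] : exists m, (hom f F)@_m != 0.
  apply: contrapT => h; case/eqP: hF; apply/mpolyP => m; rewrite mcoeff0.
  by apply: contrapT => /eqP fm; apply: h; exists m.
case/ex=> k [kF ci ij md]; split=> //.
- by rewrite (cardsD1 k) kF ci.
- by rewrite -subn_gt0 -md.
apply/dhomogP => m'; rewrite mcoeff_msupp => /ex[_ [_ _ _ md']].
by rewrite subnS -md'.
Qed.

Lemma koszul_exact (i j : nat) f :
  koszul_chain (fun=> True) i.+1 j f -> koszul_d f = 0 ->
  exists2 g, koszul_chain (fun=> True) i.+2 j g & f = koszul_d g.
Proof.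
move=> fc df0.
have ne F m : (f F)@_m != 0 -> (F != set0) || (m != 0%MM).
  move=> h; have /fc[c _ _ _] : f F != 0.
    by apply: contraNneq h => ->; rewrite mcoeff0.
  by rewrite -card_gt0 c.
exists (hom f); first exact: hom_chain.
apply/ffunP => F; apply/mpolyP => m.
have [h|] := boolP ((F != set0) || (m != 0%MM)); first by rewrite homotopy.
rewrite negb_or !negbK => /andP[/eqP-> /eqP->]; rewrite dE.
rewrite big1 => [|t _]; last by rewrite mnm0E.
by apply/eqP; apply: contraT => /ne; rewrite !eqxx.
Qed.

(* H_0 is S / (x_0, ..., x_(n-1)) = K: a polynomial is a boundary iff its
   constant term vanishes. *)
Lemma koszul_augmentation (j : nat) f : koszul_chain (fun=> True) 0 j f ->
  (exists2 g, koszul_chain (fun=> True) 1 j g & f = koszul_d g)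
    <-> (f set0)@_0%MM = 0.
Proof.
move=> fc.
have d0 g : (koszul_d g set0)@_0%MM = 0.
  by rewrite dE big1 // => t _; rewrite mnm0E.
split=> [[g _ ->] // | f0].
have ne F m : (f F)@_m != 0 -> (F != set0) || (m != 0%MM).
  by move=> h; rewrite -negb_and; apply: contraNN h => /andP[/eqP-> /eqP->]; rewrite f0.
exists (hom f); first exact: hom_chain.
have df0 : koszul_d f = 0.
  apply/ffunP => G; rewrite !ffunE big1 // => k kG.
  have [->|/fc[c _ _ _]] := eqVneq (f (k |: G)) 0; first by rewrite mulr0.
  by move: c; rewrite cardsU1 kG.
apply/ffunP => F; apply/mpolyP => m.
have [h|] := boolP ((F != set0) || (m != 0%MM)); first by rewrite homotopy.
by rewrite negb_or !negbK => /andP[/eqP-> /eqP->]; rewrite f0 d0.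
Qed.

End KoszulResolution.

(* Main.v *)
Require Import Defs.
From mathcomp Require Import all_boot all_order all_algebra.
From mathcomp Require Import boolp.
From mathcomp Require Import mpoly.

Set Implicit Arguments.
Unset Strict Implicit.
Unset Printing Implicit Defensive.

Import GRing.Theory.

(** Let [E] be a face of a complex [Gamma] such that the faces containing [E]
    are exactly the sets between [E] and one set [H]; this is what freeness of
    [E] means.  Removing from [Gamma] all faces that contain [E] enlarges the
    Stanley-Reisner ideal from [I] to [I + (x_E)].  The quotient of the two
    ideals has as a basis the monomials whose support lies between [E] and
    [H]: up to a shift by [x_E] it is the polynomial ring in the variables of
    [H], on which the other variables act by 0.  Hence its Tor with [K] lives
    only in the multidegrees [x_E x_T] with [T] disjoint from [H], in
    homological degree [#|T|], and so only on the strand [j = #|E|].  By the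
    long exact sequence, the Betti numbers of [I] and [I + (x_E)] agree off
    the strands [#|E|] and [#|E| + 1], and in every total degree [a] that is
    not of the form [#|E| + #|T|].  When [a] has this form, [E] is a facet of
    the restriction of [Gamma] to [E :|: T], a set with [a] elements.  This
    gives part (a).

    The long exact sequence is used at the level of chains: the Koszul complex
    of the quotient is contracted by division by a variable of [H], in each
    multidegree other than the exceptional ones
    ([deletion_relatively_acyclic]), and this acyclicity makes the inclusion
    of ideals bijective on Tor ([betti_relatively_acyclic]).

    For part (b), let [J = I + (x_m x_E : m in A)].  In its complex the star
    of [E] is again a simplex, with [H :\: A] in place of [H], and deleting
    this star gives the same complex as deleting the star of [E] in [Gamma].
    So [I] and [J] can both be compared with [I + (x_E)], which settles all
    strands except [#|E|] and [#|E| + 1]; and on the strands up to [#|E|] the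
    ideals [I] and [J] have the same Koszul chains, because they agree in
    degrees at most [#|E|].  Finally, if the generators of [I] have degree at
    most [d + 1], then [Gamma] and its [d]-closure have the same faces with
    more than [d] elements, so that a face [E] of [Gamma] with [d] elements
    that is free in the closure is free in [Gamma] ([star_d_closure]). *)

(** * Comparing quotients of subspaces *)

Section Quotients.
Local Open Scope ring_scope.
Variables (K : fieldType) (V : lmodType K).
Implicit Types Z B : V -> Prop.

Definition subspace Z : Prop :=
  Z 0 /\ forall a x y, Z x -> Z y -> Z (a *: x + y).

Lemma subspace_sum Z b (c : 'I_b -> K) (v : 'I_b -> V) :
  subspace Z -> (forall l, Z (v l)) -> Z (\sum_l c l *: v l).
Proof.
move=> [Z0 Zl] Zv; elim/big_rec: _ => // l x _; exact: Zl.
Qed.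

Lemma subspaceD Z x y : subspace Z -> Z x -> Z y -> Z (x + y).
Proof. by move=> [_ Zl] Zx Zy; rewrite -[x]scale1r; apply: Zl. Qed.

Lemma subspaceB Z x y : subspace Z -> Z x -> Z y -> Z (x - y).
Proof. by move=> [_ Zl] Zx Zy; rewrite addrC -scaleN1r; apply: Zl. Qed.

(** The hypotheses say that the inclusion of [Z1] in [Z2] induces a
    well-defined, injective and surjective map from [Z1] modulo [B1] to [Z2]
    modulo [B2]. *)
Lemma dim_quot_iso Z1 B1 Z2 B2 b :
  subspace Z1 -> subspace B2 ->
  (forall x, Z1 x -> Z2 x) -> (forall x, B1 x -> B2 x) ->
  (forall x, Z1 x -> B2 x -> B1 x) ->
  (forall x, Z2 x -> exists2 y, Z1 y & B2 (x - y)) ->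
  dim_quot Z1 B1 b <-> dim_quot Z2 B2 b.
Proof.
move=> sZ1 sB2 Z12 B12 inj surj; split=> [][v [Zv free span]].
  exists v; split=> [l|c Bc|z /surj[y Zy Bzy]]; first exact/Z12.
    by apply: free; apply: inj => //; apply: subspace_sum.
  have [c Bc] := span y Zy; exists c.
  by rewrite -[z](subrK y) -addrA; apply: subspaceD => //; apply: B12.
have [w wP] := choice (fun l => (exists2P _ _).1 (surj (v l) (Zv l))).
have Bvw (c : 'I_b -> K) : B2 (\sum_l c l *: v l - \sum_l c l *: w l).
  rewrite -sumrB; under eq_bigr do rewrite -scalerBr.
  by apply: subspace_sum => // l; case: (wP l).
have Zw (c : 'I_b -> K) : Z1 (\sum_l c l *: w l).
  by apply: subspace_sum => // l; case: (wP l).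
exists w; split=> [l|c /B12 Bc|z Zz]; first by case: (wP l).
  apply: free; rewrite -[\sum_l _ *: v l](subrK (\sum_l c l *: w l)).
  exact: subspaceD.
have [c Bc] := span z (Z12 _ Zz); exists c; apply: inj.
  exact: subspaceB.
by rewrite -[z](subrK (\sum_l c l *: v l)) -addrA; apply: subspaceD.
Qed.

End Quotients.

(** * Stanley-Reisner ideals in terms of monomials *)

Section StanleyReisner.
Local Open Scope ring_scope.
Variables (K : fieldType) (n : nat).
Local Notation S := {mpoly K[n]}.
Implicit Types (Gamma : {set {set 'I_n}}) (F G : {set 'I_n}) (m : 'X_{1..n}).
Implicit Types (f g : S) (Gs : {set {set 'I_n}}).

Definition msuppset m : {set 'I_n} := [set i | m i != 0%N].

Lemma msuppsetD m1 m2 : msuppset (m1 + m2) = msuppset m1 :|: msuppset m2.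
Proof. by apply/setP => i; rewrite !inE mnmDE addn_eq0 negb_and. Qed.

Lemma msuppset1 k : msuppset U_(k) = [set k].
Proof. by apply/setP => i; rewrite !inE mnm1E eqb0 negbK eq_sym. Qed.

Lemma msuppset_mesym1 F : msuppset (mesym1 F) = F.
Proof. by apply/setP => i; rewrite !inE mnmE eqb0 negbK. Qed.

Lemma mesym1_le F m : (mesym1 F <= m)%MM = (F \subset msuppset m).
Proof.
apply/mnm_lepP/subsetP => [h i iF|h i].
  by move: (h i); rewrite mnmE iF inE lt0n.
by rewrite mnmE; case: (boolP (i \in F)) => // /h; rewrite inE lt0n.
Qed.

Lemma card_msuppset m : (#|msuppset m| <= mdeg m)%N.
Proof.
have h : (mesym1 (msuppset m) <= m)%MM by rewrite mesym1_le.
by rewrite -[in leqRHS](submK h) mdegD mdeg_mesym1 leq_addl.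
Qed.

Lemma sqfreeE F : sqfree K F = 'X_[mesym1 F].
Proof.
rewrite mpolyXE_id /sqfree big_mkcond; apply: eq_bigr => i _.
by rewrite mnmE; case: (i \in F); rewrite ?expr1 ?expr0.
Qed.

(** The square-free monomial ideal whose Stanley-Reisner complex is [Gamma],
    without reference to generators: membership is decided monomial by
    monomial, on the supports. *)
Definition SR_ideal Gamma : S -> Prop :=
  fun f => forall m, m \in msupp f -> msuppset m \notin Gamma.

Definition downclosed Gamma : Prop :=
  forall F G, G \subset F -> F \in Gamma -> G \in Gamma.

Lemma SR_idealX Gamma m : SR_ideal Gamma 'X_[m] <-> msuppset m \notin Gamma.
Proof.
split=> [h|h m']; first by apply: h; rewrite msuppX inE.
by rewrite msuppX inE => /eqP->.
Qed.

Lemma SR_idealD Gamma f g :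
  SR_ideal Gamma f -> SR_ideal Gamma g -> SR_ideal Gamma (f + g).
Proof.
by move=> hf hg m /msuppD_le; rewrite mem_cat => /orP[/hf|/hg].
Qed.

Lemma SR_idealMX Gamma f F : downclosed Gamma ->
  F \notin Gamma -> SR_ideal Gamma (f * sqfree K F).
Proof.
move=> dG FG m; rewrite sqfreeE => /msuppM_le/allpairsP[[m1 m2]] /= [_].
rewrite msuppX inE => /eqP-> ->; rewrite msuppsetD msuppset_mesym1.
by apply: contra FG; apply: dG; rewrite subsetUr.
Qed.

Lemma SR_complex_ideal Gamma : SR_complex (SR_ideal Gamma) = Gamma.
Proof.
apply/setP => F; rewrite inE sqfreeE.
apply/asboolP/idP => [h|FG /SR_idealX]; last by rewrite msuppset_mesym1 FG.
by apply: contrapT => /negP FG; apply: h; apply/SR_idealX; rewrite msuppset_mesym1.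
Qed.

(** The Stanley-Reisner complex of the ideal generated by the square-free
    monomials of the members of [Gs]. *)
Definition avoid (Gs : {set {set 'I_n}}) : {set {set 'I_n}} :=
  [set F : {set 'I_n} | [forall G in Gs, ~~ (G \subset F)]].

Lemma avoidPn (Gs : {set {set 'I_n}}) F :
  reflect (exists2 G, G \in Gs & G \subset F) (F \notin avoid Gs).
Proof.
rewrite inE negb_forall; apply: (iffP existsP) => [][G].
  by rewrite negb_imply negbK => /andP[]; exists G.
by move=> GGs GF; exists G; rewrite GGs negbK.
Qed.

Lemma downclosed_avoid Gs : downclosed (avoid Gs).
Proof.
move=> F G GF; apply: contraLR => /avoidPn[H HGs HG]; apply/avoidPn.
by exists H => //; apply: subset_trans GF.
Qed.

Lemma ideal_gen_sqfree Gs f :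
  ideal_gen (fun g => exists2 F, F \in Gs & g = sqfree K F) f <->
  SR_ideal (avoid Gs) f.
Proof.
split=> [[k [c [g [hg ->]]]]|hf].
  elim/big_rec: _ => [m|i x _ hx]; first by rewrite msupp0.
  apply: SR_idealD => //; have [F FGs ->] := hg i.
  apply: SR_idealMX; first exact: downclosed_avoid.
  by apply/avoidPn; exists F.
pose m (i : 'I_(size (msupp f))) := nth 0%MM (msupp f) i.
have mP i : exists2 F, F \in Gs & F \subset msuppset (m i).
  by apply/avoidPn/hf/mem_nth.
have [F FP] := choice (fun i => (exists2P _ _).1 (mP i)).
(* Each monomial of f is divided by one generator. *)
exists (size (msupp f)), (fun i => f@_(m i) *: 'X_[m i - mesym1 (F i)]).
exists (fun i => sqfree K (F i)); split=> [i|].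
  by exists (F i) => //; case: (FP i).
rewrite {1}[f]mpolyE (big_nth 0%MM) big_mkord; apply: eq_bigr => i _.
have [_ Fm] := FP i; rewrite -mesym1_le in Fm.
by rewrite sqfreeE -scalerAl -mpolyXD submK.
Qed.

(** Membership being decided on monomials, an element of the right-hand side
    is split into its monomials that lie in the first ideal and the rest. *)
Lemma ideal_add_SR Gamma1 Gamma2 f :
  ideal_add (SR_ideal Gamma1) (SR_ideal Gamma2) f <->
  SR_ideal (Gamma1 :&: Gamma2) f.
Proof.
split=> [[g [h [hg hh ->]]]|hf].
  apply: SR_idealD => m; rewrite inE negb_and.
    by move/hg->.
  by move/hh->; rewrite orbT.
exists (\sum_(m <- msupp f | msuppset m \notin Gamma1) f@_m *: 'X_[m]).
exists (\sum_(m <- msupp f | ~~ (msuppset m \notin Gamma1)) f@_m *: 'X_[m]).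
split; last by rewrite {1}[f]mpolyE (bigID (fun m => msuppset m \notin Gamma1)).
  elim/big_rec: _ => [m|m x hm hx]; first by rewrite msupp0.
  by apply: SR_idealD => // m' /msuppZ_le; move: m'; apply/SR_idealX.
rewrite big_seq_cond; elim/big_rec: _ => [m|m x /andP[/hf hm]].
  by rewrite msupp0.
rewrite negbK => hm1; apply: SR_idealD => // m' /msuppZ_le.
by move: m'; apply/SR_idealX; move: hm; rewrite inE hm1.
Qed.

Lemma sqfree_monomial_idealE (I : S -> Prop) : sqfree_monomial_ideal I ->
  I = SR_ideal (SR_complex I) /\ downclosed (SR_complex I).
Proof.
case=> Gs IGs.
have -> : I = SR_ideal (avoid Gs).
  by apply/funext => f; apply/propext; rewrite IGs ideal_gen_sqfree.
by rewrite SR_complex_ideal; split=> //; apply: downclosed_avoid.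
Qed.

End StanleyReisner.

(** * Koszul chains in coordinates *)

Section KoszulChains.
Local Open Scope ring_scope.
Variables (K : fieldType) (n : nat).
Local Notation S := {mpoly K[n]}.
Implicit Types (Gamma Delta : {set {set 'I_n}}) (E F G H T : {set 'I_n}).
Implicit Types (m : 'X_{1..n}) (f g h : {ffun {set 'I_n} -> S}) (k t : 'I_n).

Local Notation chain Gamma := (koszul_chain (@SR_ideal K n Gamma)).
Local Notation below G k := #|[set l in G | (l < k)%N]|.

(** The coefficient of [f F] at [m] is that of the Koszul basis element
    [x^m e_F], whose internal degree is [mdeg m + #|F|].  All arguments below
    are about these coefficients. *)
Lemma koszul_chainP Gamma i a f :
  chain Gamma i a f <->
  (forall F m, (f F)@_m != 0 ->
     [/\ #|F| = i, (mdeg m + i)%N = a & msuppset m \notin Gamma]).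
Proof.
split=> [fc F m fm|fc F fF].
  have /fc[Fi ia fG fh] : f F != 0 by apply: contraNneq fm => ->; rewrite mcoeff0.
  rewrite -mcoeff_msupp in fm; split=> //; last exact: fG.
  by move/dhomogP: fh => /(_ _ fm) /= ->; rewrite subnK.
have [m fm] : exists m, (f F)@_m != 0.
  apply: contrapT => fz; case/eqP: fF; apply/mpolyP => m; rewrite mcoeff0.
  by apply: contrapT => /eqP fm; apply: fz; exists m.
have [Fi mi _] := fc _ _ fm; split=> //.
- by rewrite -mi leq_addl.
- by move=> m'; rewrite mcoeff_msupp => /fc[].
apply/dhomogP => m'; rewrite mcoeff_msupp => /fc[_ <- _].
by rewrite addnK.
Qed.

Lemma koszul_dE f G m : (koszul_d f G)@_m =
  \sum_(t | (t \notin G) && (m t != 0%N))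
     (-1) ^+ below G t * (f (t |: G))@_(m - U_(t)).
Proof.
rewrite ffunE raddf_sum /= big_mkcondr /=; apply: eq_bigr => t _.
have -> : (-1) ^+ below G t = ((-1) ^+ below G t)%:MP_[n] :> S.
  by rewrite rmorphXn rmorphN1.
rewrite -mulrA mcoeffCM; case: ifPn => mt.
  congr (_ * _); rewrite -[in LHS](@submK _ U_(t) m) ?lep1mP //.
  by rewrite addmC mulrC mcoeffMX.
suff -> : ('X_t * f (t |: G))@_m = 0 by rewrite mulr0.
apply/eqP; rewrite mcoeff_eq0; apply: contra mt => /msuppM_le/allpairsP[[m1 m2]] /=.
by rewrite msuppX inE => -[/eqP-> _ ->]; rewrite mnmDE mnm1E eqxx.
Qed.

Lemma koszul_d_linear c f g :
  koszul_d (c *: f + g) = c *: koszul_d f + koszul_d g.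
Proof.
apply/ffunP => G; rewrite !ffunE scaler_sumr -big_split; apply: eq_bigr => k _.
by rewrite !ffunE mulrDr -scalerAr.
Qed.

Lemma koszul_chain_d Gamma i a g : downclosed Gamma ->
  chain Gamma i.+1 a g -> chain Gamma i a (koszul_d g).
Proof.
move=> dG /koszul_chainP gc; apply/koszul_chainP => G m; rewrite koszul_dE => nz.
have [t /andP[tG mt] /gc[]] : exists2 t,
    (t \notin G) && (m t != 0%N) & (g (t |: G))@_(m - U_(t)) != 0.
  apply: contrapT => gz; case/eqP: nz; apply: big1 => t tP.
  have [->|gt] := eqVneq (g (t |: G))@_(m - U_(t)) 0; first by rewrite mulr0.
  by case: gz; exists t.
rewrite cardsU1 tG add1n => -[Gi] mi mG; split=> //.
  by rewrite -mi -[in LHS](@submK _ U_(t) m) ?lep1mP // mdegD mdeg1 -addnA add1n.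
apply: contra mG; apply: dG; apply/subsetP => l.
by rewrite !inE mnmBE; apply: contra => /eqP->.
Qed.

Lemma subspace_chain Gamma i a : subspace (chain Gamma i a).
Proof.
split=> [|c f g /koszul_chainP fc /koszul_chainP gc].
  by move=> F; rewrite ffunE eqxx.
apply/koszul_chainP => F m; rewrite !ffunE mcoeffD mcoeffZ => nz.
have [fm|/fc//] := eqVneq (f F)@_m 0; apply: gc.
by apply: contraNneq nz => ->; rewrite fm mulr0 addr0.
Qed.

Lemma koszul_dB f g : koszul_d (f - g) = koszul_d f - koszul_d g.
Proof. by rewrite addrC -scaleN1r koszul_d_linear scaleN1r addrC. Qed.

Lemma koszul_d0 : koszul_d (0 : {ffun {set 'I_n} -> S}) = 0.
Proof. by have := koszul_dB 0 0; rewrite !subrr. Qed.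

Lemma subspace_cycle Gamma i a : subspace (tor_cycle (@SR_ideal K n Gamma) i a).
Proof.
have [c0 cl] := subspace_chain Gamma i a; split=> [|c f g [fc df] [gc dg]].
  by split=> //; apply: koszul_d0.
by split; [apply: cl | rewrite koszul_d_linear df dg scaler0 addr0].
Qed.

Lemma subspace_boundary Gamma i a :
  subspace (tor_boundary (@SR_ideal K n Gamma) i a).
Proof.
have [c0 cl] := subspace_chain Gamma i.+1 a.
split=> [|c _ _ [f fc ->] [g gc ->]]; first by exists 0; rewrite ?koszul_d0.
by exists (c *: f + g); [apply: cl | rewrite koszul_d_linear].
Qed.

Lemma koszul_chainS Gamma Delta i a f : Delta \subset Gamma ->
  chain Gamma i a f -> chain Delta i a f.
Proof.
move=> DG fc F /fc[Fi ia fG fh]; split=> // m /fG; apply: contra.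
exact: (subsetP DG).
Qed.

(** Vanishing of the homology at homological degree [i] and internal degree
    [a] of the Koszul complex of the quotient of the ideal of [Delta] by the
    ideal of [Gamma], written with representatives. *)
Definition relatively_acyclic Gamma Delta i a : Prop :=
  forall g, chain Delta i a g -> (forall G, SR_ideal Gamma (koszul_d g G)) ->
  exists2 h, chain Delta i.+1 a h & chain Gamma i a (g - koszul_d h).

(** The part of the long exact sequence of Tor that is needed: surjectivity
    uses acyclicity of the quotient in degree [i], injectivity in degree
    [i.+1]. *)
Lemma betti_relatively_acyclic Gamma Delta i a :
  downclosed Delta -> Delta \subset Gamma ->
  relatively_acyclic Gamma Delta i a ->
  relatively_acyclic Gamma Delta i.+1 a ->
  betti (@SR_ideal K n Delta) i a = betti (@SR_ideal K n Gamma) i a.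
Proof.
move=> dD DG exi exi1; rewrite /betti.
suff -> : dim_quot (tor_cycle (@SR_ideal K n Delta) i a)
            (tor_boundary (@SR_ideal K n Delta) i a) =
          dim_quot (tor_cycle (@SR_ideal K n Gamma) i a)
            (tor_boundary (@SR_ideal K n Gamma) i a) by [].
apply/funext => b; apply/propext; apply: iff_sym; apply: dim_quot_iso.
- exact: subspace_cycle.
- exact: subspace_boundary.
- by move=> f [fc df]; split=> //; apply: koszul_chainS fc.
- by move=> f [g gc ->]; exists g => //; apply: koszul_chainS gc.
- move=> f [fc _] [g gc fg].
  have [|h hc gh] := exi1 g gc.
    move=> G; rewrite -fg; have [->|/fc[]//] := eqVneq (f G) 0.
    by move=> m; rewrite msupp0.
  by exists (g - koszul_d h); rewrite // koszul_dB koszul_dK subr0.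
move=> f [fc df]; have [|h hc fh] := exi f fc.
  by move=> G m; rewrite df ffunE msupp0.
exists (f - koszul_d h); last by exists h; rewrite ?subKr.
by split; rewrite // koszul_dB df koszul_dK subr0.
Qed.

Lemma poly_family N (c : {set 'I_n} -> 'X_{1..n} -> K) :
  (forall F m, c F m != 0 -> (mdeg m < N)%N) ->
  exists h : {ffun {set 'I_n} -> S}, forall F m, (h F)@_m = c F m.
Proof.
move=> cN; exists [ffun F => \sum_(m : 'X_{1..n < N}) c F m *: 'X_[m]] => F m.
have [mN|Nm] := ltnP (mdeg m) N; first by rewrite ffunE mcoeff_mpoly.
have -> : c F m = 0.
  by apply/eqP; apply: contraTT Nm => /cN; rewrite -ltnNge.
rewrite ffunE raddf_sum big1 //= => m' _; rewrite mcoeffZ mcoeffX.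
case: eqP => [e|_]; last by rewrite mulr0.
by move: (bmdeg m'); rewrite e ltnNge Nm.
Qed.

Lemma belowU1 G k t : t \notin G -> below (t |: G) k = ((t < k)%N + below G k)%N.
Proof.
move=> tG; case: (boolP (t < k)%N) => tk.
  rewrite (_ : [set l in t |: G | _] = t |: [set l in G | (l < k)%N]).
    by rewrite cardsU1 inE (negbTE tG).
  by apply/setP => l; rewrite !inE; case: eqP => [->|]; rewrite ?tk.
apply: eq_card => l; rewrite !inE; case: eqP => [->|//].
by rewrite (negbTE tk) !andbF.
Qed.

(** The reason why the cross terms in the homotopy formula cancel. *)
Lemma koszul_sign G k t : k \notin G -> t \notin G -> k != t ->
  (-1) ^+ below (k |: G) t * (-1) ^+ below (t |: G) k
  = - ((-1) ^+ below G k * (-1) ^+ below G t) :> K.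
Proof.
move=> kG tG; rewrite -(inj_eq val_inj) /= neq_ltn => kt.
rewrite !belowU1 // mulrC; case: (ltngtP k t) kt => //= _ _;
by rewrite add0n add1n exprS mulN1r ?mulrN ?mulNr.
Qed.

(** * Contracting the Koszul complex of the quotient *)

Definition deletion Gamma E : {set {set 'I_n}} :=
  [set F in Gamma | ~~ (E \subset F)].

(** The usable form of freeness: a face [E] is free exactly when this holds for
    some [H], which is then the only facet containing [E]. *)
Definition star_is_simplex Gamma E H : Prop :=
  E \subset H /\ forall F, E \subset F -> (F \in Gamma) = (F \subset H).

Lemma downclosed_deletion Gamma E :
  downclosed Gamma -> downclosed (deletion Gamma E).
Proof.
move=> dG F G GF; rewrite !inE => /andP[FG EF]; rewrite (dG _ _ GF) //=.
by apply: contra EF => EG; apply: subset_trans GF.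
Qed.

Lemma mesym1U1 F t : t \notin F -> mesym1 (t |: F) = (U_(t) + mesym1 F)%MM.
Proof.
move=> tF; apply/mnmP => l; rewrite !(mnmE, mnmDE) !inE eq_sym.
by case: eqP => [<-|]; rewrite ?(negbTE tF).
Qed.

(** In the quotient of the two ideals, a basis element [x^m e_F] has
    multidegree [mu = m + mesym1 F], which the differential preserves.  If some
    variable [k] of [H] occurs in [mu] more often than in [x_E], then sending
    [x^m e_F] to [x^(m - U_(k)) e_(k |: F)] when [k] is outside [F], and to 0
    otherwise, is a contracting homotopy in this multidegree, up to signs:
    [x_E] still divides [x^(m - U_(k))], and [x_k] is not a zero divisor on the
    quotient.  The choice of [k] depends on [mu] alone, so all terms of the
    homotopy formula use the same [k].  If there is no such [k], then
    [x^m = x_E] and [F] is disjoint from [H], which the hypothesis on [T]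
    excludes. *)
Lemma deletion_relatively_acyclic Gamma E H i a :
  downclosed Gamma -> star_is_simplex Gamma E H ->
  (forall T, [disjoint T & H] -> #|T| = i -> (#|E| + i)%N <> a) ->
  relatively_acyclic Gamma (deletion Gamma E) i a.
Proof.
move=> dG [EH star] crit g gc dgG.
have /koszul_chainP gP := gc.
(* The monomials that form a basis of the quotient. *)
pose live m := (E \subset msuppset m) && (msuppset m \subset H).
have liveE m :
    live m = (msuppset m \in Gamma) && (msuppset m \notin deletion Gamma E).
  rewrite /live [in RHS]inE; case: (boolP (E \subset msuppset m)) => [/star->|_].
    by rewrite andbF andbT.
  by rewrite andbT andbN.
pose pivot mu := [pick k | (k \in H) && ((k \in E) < (mu : 'X_{1..n}) k)%N].
(* The coefficients of the image of g under the homotopy. *)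
pose c G m := if pivot (m + mesym1 G)%MM is Some k then
    if (k \in G) && live (m + U_(k))%MM then
      (-1) ^+ below (G :\ k) k * (g (G :\ k))@_(m + U_(k))
    else 0 else 0.
have cP G m : c G m != 0 -> [/\ #|G| = i.+1, (mdeg m + i.+1)%N = a &
    msuppset m \notin deletion Gamma E].
  rewrite /c /pivot; case: pickP => [k /andP[kH]|]; last by rewrite eqxx.
  case: ifP => [/andP[kG lk]|_]; last by rewrite eqxx.
  rewrite mnmDE mnmE kG => kE nz.
  have /gP[Gi mi _] : (g (G :\ k))@_(m + U_(k)) != 0.
    by apply: contraNneq nz => ->; rewrite mulr0.
  split; first by rewrite (cardsD1 k) kG Gi.
    by rewrite -mi mdegD mdeg1 -addnA.
  rewrite inE negb_and negbK; apply/orP; right; apply/subsetP => l lE.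
  have [/subsetP/(_ l lE) + _] := andP lk; rewrite !inE mnmDE mnm1E.
  have [kl|_] := eqVneq k l; last by rewrite addn0.
  by move: kE; rewrite kl lE addn1 ltnS lt0n.
have [F m /cP[_ <- _]|h hE] := @poly_family a.+1 c; first by rewrite ltnS leq_addr.
have hc : chain (deletion Gamma E) i.+1 a h.
  by apply/koszul_chainP => F m; rewrite hE; apply: cP.
exists h => //.
have /koszul_chainP wP : chain (deletion Gamma E) i a (g - koszul_d h).
  apply: (subspaceB (subspace_chain _ _ _)) => //.
  by apply: koszul_chain_d => //; apply: downclosed_deletion.
apply/koszul_chainP => F m nz; have [Fi mi mD] := wP F m nz; split=> //.
apply/negP => mG; have lm : live m by rewrite liveE mG.
have /andP[Em mH] := lm.
have muE t : t \notin F -> m t != 0%N ->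
    (m - U_(t) + mesym1 (t |: F) = m + mesym1 F)%MM.
  by move=> tF mt; rewrite mesym1U1 // addmA submK ?lep1mP.
(* It remains to see that g - d h has no live coefficient: without a pivot,
   the multidegree is exceptional; with a pivot k, this is the homotopy
   formula. *)
case pv: (pivot (m + mesym1 F)%MM) => [k|]; last first.
  move: pv; rewrite /pivot; case: pickP => // nopivot _.
  have EF l : l \in H -> (m l + (l \in F) <= (l \in E))%N.
    by move=> lH; move: (nopivot l); rewrite lH mnmDE mnmE ltnNge => /negbFE.
  have Em1 l : l \in E -> (0 < m l)%N.
    by move/(subsetP Em); rewrite inE lt0n.
  have mE : m = mesym1 E.
    apply/mnmP => l; rewrite mnmE; case: (boolP (l \in H)) => [/EF|lH].
      case: (boolP (l \in E)) => [/Em1|_]; first by case: (m l) => [|[]].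
      by case: (m l).
    rewrite (negbTE (contra (subsetP EH l) lH)).
    by apply/eqP; apply: contraNT lH => ml; apply: (subsetP mH); rewrite inE.
  have FH : [disjoint F & H].
    rewrite disjoint_subset; apply/subsetP => l lF; rewrite inE.
    by apply/negP => /EF; rewrite mE mnmE lF; case: (l \in E).
  by case: (crit F FH Fi); rewrite -mi mE mdeg_mesym1.
have [kH kE] : k \in H /\ ((k \in E) < (m + mesym1 F)%MM k)%N.
  by move: pv; rewrite /pivot; case: pickP => // l /andP[lH lE] [<-].
have cE t : t \notin F -> m t != 0%N -> c (t |: F) (m - U_(t))%MM =
    if (k \in t |: F) && live (m - U_(t) + U_(k))%MM then
      (-1) ^+ below ((t |: F) :\ k) k * (g ((t |: F) :\ k))@_(m - U_(t) + U_(k))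
    else 0.
  by move=> tF mt; rewrite /c muE // pv.
have dE : (koszul_d h F)@_m = \sum_(t | (t \notin F) && (m t != 0%N))
    (-1) ^+ below F t * c (t |: F) (m - U_(t))%MM.
  by rewrite koszul_dE; apply: eq_bigr => t _; rewrite hE.
case/eqP: nz; rewrite ffunE [X in _ + X]ffunE mcoeffB dE.
(* If k is not in F, only the term t = k of d h survives, and it is g. *)
have [kF|kF] := boolP (k \in F); last first.
  have mk : m k != 0%N.
    move: kE; rewrite mnmDE mnmE (negbTE kF) addn0 => kE.
    by rewrite -lt0n; apply: leq_ltn_trans kE.
  rewrite (bigD1 k) /= ?kF // cE // setU11 submK ?lep1mP // lm /= setU1K //.
  rewrite mulrA -expr2 sqrr_sign mul1r big1 ?addr0 ?subrr // => t.
  case/andP=> /andP[tF mt] tk; rewrite cE // !inE eq_sym (negbTE tk) (negbTE kF).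
  by rewrite mulr0.
(* If k is in F, the vanishing of d g at x^(m + U_(k)) e_(F - k) expresses g by
   the other faces, and these terms cancel those of d h pairwise. *)
have lmk : msuppset (m + U_(k)) \in Gamma.
  rewrite star ?msuppsetD ?msuppset1.
    by rewrite subUset mH sub1set.
  by apply: subset_trans Em _; rewrite subsetUl.
have : (koszul_d g (F :\ k))@_(m + U_(k)) = 0.
  by apply/eqP; rewrite mcoeff_eq0; apply: contraL lmk; apply: dgG.
rewrite koszul_dE (bigD1 k) /=; last by rewrite !inE eqxx mnmDE mnm1E eqxx addn1.
rewrite addmK setD1K // => /eqP; rewrite addr_eq0 => /eqP gF.
have -> : (g F)@_m = - ((-1) ^+ below (F :\ k) k *
   \sum_(t | (t \notin F) && (m t != 0%N))
   (-1) ^+ below (F :\ k) t * (g (t |: F :\ k))@_(m + U_(k) - U_(t))).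
  rewrite -[LHS](signrMK (below (F :\ k) k)) gF mulrN.
  congr (- (_ * _)); apply: eq_bigl => t; rewrite !inE mnmDE mnm1E.
  have [->|tk] := eqVneq t k; first by rewrite kF andbF.
  by rewrite andbT addn0.
apply/eqP; rewrite mulr_sumr -opprD oppr_eq0 -big_split /= big1 // => t /andP[tF mt].
have kt : k != t by apply: contraNneq tF => <-.
have shift : (m + U_(k) - U_(t) = m - U_(t) + U_(k))%MM.
  apply/mnmP => l; rewrite !(mnmDE, mnmBE, mnm1E).
  by have [<-|] := eqVneq t l; rewrite ?subn0 // addnBAC // lt0n.
have swap : (t |: F) :\ k = t |: F :\ k.
  by apply/setP => l; rewrite !inE; have [->|] := eqVneq l t; rewrite 1?eq_sym ?kt.
rewrite cE // !inE kF orbT /= swap shift; case: ifPn => [_|nl].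
  have /= := @koszul_sign (F :\ k) k t; rewrite !inE eqxx (negbTE tF) andbF.
  move=> /(_ isT isT kt); rewrite setD1K // => sgn.
  by rewrite !mulrA sgn -mulrDl addrN mul0r.
(* The homotopy drops monomials that are not live; g has none of them here,
   since the support cannot leave Gamma when U_(t) is removed. *)
suff -> : (g (t |: F :\ k))@_(m - U_(t) + U_(k)) = 0 by rewrite !mulr0 addr0.
apply: contraNeq nl => /gP[_ _ nD]; rewrite liveE nD andbT.
apply: dG lmk; rewrite -shift; apply/subsetP => l.
by rewrite !inE mnmBE; apply: contra => /eqP->.
Qed.

(** * Deleting the star of a free face *)

Lemma deletion_sub Gamma E : deletion Gamma E \subset Gamma.
Proof. by apply/subsetP => F; rewrite inE => /andP[]. Qed.

Lemma betti_deletion Gamma E H i a :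
  downclosed Gamma -> star_is_simplex Gamma E H ->
  (forall T, [disjoint T & H] -> (#|T| = i \/ #|T| = i.+1) ->
     (#|E| + #|T|)%N <> a) ->
  betti (@SR_ideal K n (deletion Gamma E)) i a = betti (@SR_ideal K n Gamma) i a.
Proof.
move=> dG star crit; apply: betti_relatively_acyclic.
- exact: downclosed_deletion.
- exact: deletion_sub.
- apply: deletion_relatively_acyclic star _ => // T TH Ti.
  by rewrite -Ti; apply: crit; auto.
- apply: deletion_relatively_acyclic star _ => // T TH Ti.
  by rewrite -Ti; apply: crit; auto.
Qed.

(** The two excluded strands are those where the exceptional multidegrees
    contribute to Tor of the quotient in homological degree [i] and [i.+1]. *)
Lemma betti_deletion_strand Gamma E H i j :
  downclosed Gamma -> star_is_simplex Gamma E H ->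
  j <> #|E| -> j <> #|E|.+1 ->
  betti (@SR_ideal K n (deletion Gamma E)) i (i + j) =
  betti (@SR_ideal K n Gamma) i (i + j).
Proof.
move=> dG star jE jE1; apply: betti_deletion star _ => // T _ Ti ijE.
case: Ti ijE => ->; first by rewrite addnC => /addnI/esym.
by rewrite addnS -addSn addnC => /addnI/esym.
Qed.

(** If [T] is disjoint from [H], then [E] is a facet of the restriction of
    [Gamma] to [E :|: T], because every face containing [E] lies in [H]; so the
    exceptional multidegrees do not occur in degree [a]. *)
Lemma betti_deletion_no_facet Gamma E H a :
  downclosed Gamma -> star_is_simplex Gamma E H ->
  (forall W : {set 'I_n}, #|W| = a -> ~ facet (restr Gamma W) E) ->
  forall i, betti (@SR_ideal K n (deletion Gamma E)) i a =
    betti (@SR_ideal K n Gamma) i a.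
Proof.
move=> dG star nf i; apply: betti_deletion (star) _ => // T TH _ Ta.
have [EH starE] := star.
have ET : [disjoint E & T].
  by rewrite disjoint_sym; apply: disjointWr TH.
apply: (nf (E :|: T)); first by rewrite cardsU disjoint_setI0 // cards0 subn0.
apply/maxsetP; rewrite !inE starE // EH subsetUl; split=> // B.
rewrite !inE => /andP[BG BW] EB; apply/eqP; rewrite eqEsubset EB andbT.
rewrite starE // in BG; apply/subsetP => l lB.
have := subsetP BW l lB; rewrite inE => /orP[//|lT].
by have := subsetP BG l lB; rewrite (disjointFr TH lT).
Qed.

(** Chains on the strand [j] have coefficients of degree at most [j], and the
    two ideals agree in degrees up to [d]. *)
Lemma betti_low_strand Gamma Delta d i j :
  downclosed Delta -> Delta \subset Gamma ->
  (forall F, F \in Gamma -> F \notin Delta -> (d < #|F|)%N) -> (j <= d)%N ->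
  betti (@SR_ideal K n Delta) i (i + j) = betti (@SR_ideal K n Gamma) i (i + j).
Proof.
move=> dD DG low jd.
have acyclic i' : (i <= i')%N -> relatively_acyclic Gamma Delta i' (i + j).
  move=> ii' g /koszul_chainP gc _; exists 0.
    by case: (subspace_chain Delta i'.+1 (i + j)).
  apply/koszul_chainP => F m; rewrite koszul_d0 subr0 => /gc[Fi mi mD].
  split=> //; apply/negP => /low/(_ mD); apply/negP; rewrite -leqNgt.
  apply: leq_trans (card_msuppset m) _; apply: leq_trans jd.
  by rewrite -(leq_add2r i') mi addnC leq_add2l.
by apply: betti_relatively_acyclic => //; apply: acyclic.
Qed.

End KoszulChains.

(** * Free faces *)

Section FreeFaces.
Local Open Scope ring_scope.
Variables (n : nat).
Implicit Types (Gamma : {set {set 'I_n}}) (E F G H A : {set 'I_n}).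

Lemma free_face_star Gamma E : downclosed Gamma -> free_face Gamma E ->
  exists H, star_is_simplex Gamma E H.
Proof.
move=> dG /andP[EG /cards1P[H facets]].
have facetH G : (facet Gamma G && (E \subset G)) = (G == H).
  by have /setP/(_ G) := facets; rewrite !inE.
have := facetH H; rewrite eqxx => /andP[/maxsetP[HG _] EH].
exists H; split=> // F EF; apply/idP/idP => [FG|]; last by move/dG; apply.
have [G GF FG'] := @maxset_exists _ [pred G in Gamma] F FG.
by have := facetH G; rewrite /facet GF (subset_trans EF FG') => /esym/eqP <-.
Qed.

Lemma downclosed_d_closure d Gamma : downclosed (d_closure d Gamma).
Proof.
move=> F G GF; rewrite !inE => /orP[Fd|/forallP h].
  by rewrite (leq_trans (subset_leq_card GF) Fd).
apply/orP; right; apply/forallP => L; apply/implyP => /andP[LG Ld].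
by apply: (implyP (h L)); rewrite Ld andbT; apply: subset_trans GF.
Qed.

(** The Stanley-Reisner complex of [I + (x_m x_E : m in A)], when that of [I]
    is [Gamma]; see [ideal_add_sqfreeX]. *)
Definition delete_stars Gamma E A : {set {set 'I_n}} :=
  [set F in Gamma | [forall m in A, ~~ (m |: E \subset F)]].

Lemma star_delete_stars Gamma E H A : A \subset ~: E ->
  star_is_simplex Gamma E H ->
  star_is_simplex (delete_stars Gamma E A) E (H :\: A).
Proof.
move=> AE [EH star]; have EA : [disjoint E & A].
  by rewrite disjoint_sym disjoints_subset.
have noA F : E \subset F ->
    [forall m in A, ~~ (m |: E \subset F)] = [disjoint F & A].
  move=> EF; rewrite disjoint_sym disjoints_subset; apply/forallP/subsetP => h m.
    by move=> mA; move: (h m); rewrite mA subUset EF sub1set andbT inE.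
  by apply/implyP => /h; rewrite inE subUset EF sub1set andbT.
split=> [|F EF]; first by rewrite subsetD EH EA.
by rewrite inE star // noA // subsetD.
Qed.

Lemma deletion_delete_stars Gamma E A :
  deletion (delete_stars Gamma E A) E = deletion Gamma E.
Proof.
apply/setP => F; rewrite !inE; case: (boolP (E \subset F)) => EF.
  by rewrite !andbF.
rewrite !andbT; case: (F \in Gamma) => //=; apply/forallP => m.
by apply/implyP => _; apply: contra EF; apply: subset_trans; apply: subsetUr.
Qed.

Lemma downclosed_delete_stars Gamma E A :
  downclosed Gamma -> downclosed (delete_stars Gamma E A).
Proof.
move=> dG F G GF; rewrite !inE => /andP[FG /forallP h]; rewrite (dG _ _ GF) //=.
apply/forallP => m; apply/implyP => mA; have := implyP (h m) mA.
by apply: contra => mG; apply: subset_trans GF.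
Qed.

End FreeFaces.

(** * Generators of bounded degree *)

Section Generators.
Local Open Scope ring_scope.
Variables (K : fieldType) (n : nat).
Local Notation S := {mpoly K[n]}.
Implicit Types (Gamma : {set {set 'I_n}}) (E F G H A : {set 'I_n}).

Lemma min_mono_gen_exists (I : S -> Prop) m : I 'X_[m] ->
  exists2 m', (m' <= m)%MM & min_mono_gen I m'.
Proof.
elim: {m}(mdeg m) {-2}m (leqnn (mdeg m)) => [|e IH] m.
  rewrite leqn0 mdeg_eq0 => /eqP-> I0; exists 0%MM; first exact: lepm_refl.
  split=> // m' /mnm_lepP h _; apply/mnmP => i; apply/eqP.
  by move: (h i); rewrite mnm0E leqn0.
move=> me Im; have [[m' [m'm Im' ne]]|h] :=
    pselect (exists m', [/\ (m' <= m)%MM, I 'X_[m'] & m' <> m]).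
  have [|m'' m''m' mg] := IH m' _ Im'; last by exists m'' => //; apply: lepm_trans m'm.
  rewrite -ltnS (leq_trans _ me) //; rewrite -[in ltnRHS](submK m'm) mdegD.
  rewrite -[ltnLHS]add0n ltn_add2r lt0n mdeg_eq0; apply/eqP => m0.
  by apply: ne; rewrite -[RHS](submK m'm) m0 add0m.
exists m; first exact: lepm_refl.
by split=> // m' m'm Im'; apply: contrapT => ne; apply: h; exists m'.
Qed.

Lemma nonface_generator Gamma d F :
  (forall m, min_mono_gen (@SR_ideal K n Gamma) m -> (mdeg m <= d)%N) ->
  F \notin Gamma ->
  exists2 G : {set 'I_n}, G \subset F & (#|G| <= d)%N && (G \notin Gamma).
Proof.
move=> gens FG.
have [|m mF mg] := @min_mono_gen_exists (SR_ideal Gamma) (mesym1 F).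
  by apply/SR_idealX; rewrite msuppset_mesym1.
exists (msuppset m).
  by rewrite -[F]msuppset_mesym1 -(submK mF) msuppsetD subsetUr.
rewrite (leq_trans (card_msuppset m) (gens m mg)) /=.
by case: mg => /SR_idealX.
Qed.

Lemma subset_between F G k : G \subset F -> (#|G| <= k)%N -> (k <= #|F|)%N ->
  exists L : {set 'I_n}, [/\ G \subset L, L \subset F & #|L| = k].
Proof.
move=> GF Gk kF.
have : (0 < #|[set D : {set 'I_n} | (D \subset F :\: G) & #|D| == k - #|G|]|)%N.
  by rewrite cards_draws bin_gt0 cardsDS // leq_sub2r.
case/card_gt0P => D; rewrite inE subsetD => /andP[/andP[DF DG] /eqP Dk].
exists (G :|: D); split; rewrite ?subsetUl ?subUset ?GF //.
by rewrite cardsU setIC disjoint_setI0 // cards0 subn0 Dk subnKC.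
Qed.

(** A set with more than [d] elements all of whose [d.+1]-element subsets are
    faces of [Gamma] is itself a face: a non-face contains a non-face with at
    most [d.+1] elements, which extends to one with exactly [d.+1] elements.
    Hence [Gamma] and its [d]-closure can differ only in sets with at most [d]
    elements, and [E] is the only such set that contains [E]. *)
Lemma star_d_closure Gamma E d H : downclosed Gamma ->
  (forall m, min_mono_gen (@SR_ideal K n Gamma) m -> (mdeg m <= d.+1)%N) ->
  #|E| = d -> E \in Gamma ->
  star_is_simplex (d_closure d Gamma) E H -> star_is_simplex Gamma E H.
Proof.
move=> dG gens Ed EG [EH star]; split=> // F EF; rewrite -star // inE.
have [Fd|dF] /= := leqP #|F| d.
  suff -> : F = E by [].
  by apply/esym/eqP; rewrite eqEcard EF Ed.
apply/idP/forallP => [FG G|h].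
  by apply/implyP => /andP[GF _]; apply: dG FG.
apply: contraT => FG; have [G GF /andP[Gd GG]] := nonface_generator gens FG.
have [L [GL LF Ld]] := subset_between GF Gd dF.
by case/negP: GG; apply: dG GL _; apply: (implyP (h L)); rewrite LF Ld eqxx.
Qed.

Lemma ideal_add_sqfree Gamma E :
  ideal_add (@SR_ideal K n Gamma) (ideal_gen (fun g => g = sqfree K E)) =
  SR_ideal (deletion Gamma E).
Proof.
have -> : deletion Gamma E = Gamma :&: avoid [set E].
  apply/setP => F; rewrite !inE; congr (_ && _).
  apply/idP/forallP => [EF G|/(_ E)]; last by rewrite inE eqxx.
  by rewrite inE; apply/implyP => /eqP->.
apply/funext => f; apply/propext; rewrite -ideal_add_SR.
suff -> : ideal_gen (fun g => g = sqfree K E) = SR_ideal (avoid [set E]) by [].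
apply/funext => h; apply/propext; rewrite -ideal_gen_sqfree.
suff -> : (fun g => g = sqfree K E) =
    (fun g => exists2 F, F \in [set E] & g = sqfree K F) by [].
apply/funext => g; apply/propext; split=> [->|[F]]; first by exists E; rewrite ?inE.
by rewrite inE => /eqP->.
Qed.

Lemma ideal_add_sqfreeX Gamma E A : A \subset ~: E ->
  ideal_add (@SR_ideal K n Gamma)
    (ideal_gen (fun g => exists2 m : 'I_n, m \in A & g = 'X_m * sqfree K E)) =
  SR_ideal (delete_stars Gamma E A).
Proof.
move=> AE; pose Gs := [set m |: E | m in A].
have -> : delete_stars Gamma E A = Gamma :&: avoid Gs.
  apply/setP => F; rewrite !inE; congr (_ && _).
  apply/forallP/forallP => [h G|h m]; apply/implyP.
    by case/imsetP => m mA ->; apply: (implyP (h m)).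
  by move=> mA; apply: (implyP (h _)); apply: imset_f.
apply/funext => f; apply/propext; rewrite -ideal_add_SR.
set xA := ideal_gen _; suff -> : xA = SR_ideal (avoid Gs) by [].
apply/funext => h; apply/propext; rewrite -ideal_gen_sqfree /xA.
set P := fun _ => _; set Q := fun _ => _; suff -> : P = Q by [].
have XE m : m \in A -> 'X_m * sqfree K E = sqfree K (m |: E).
  by move/(subsetP AE); rewrite inE => mE; rewrite /sqfree big_setU1.
apply/funext => g; apply/propext; split=> [[m mA ->]|[F /imsetP[m mA ->] ->]].
  by exists (m |: E); rewrite ?XE //; apply: imset_f.
by exists m; rewrite ?XE.
Qed.

End Generators.

Theorem theorem4p4 (K : fieldType) (n d : nat)
    (I : {mpoly K[n]} -> Prop) (hI : sqfree_monomial_ideal I)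
    (E : {set 'I_n}) (hE : #|E| = d) :
  let Gamma := SR_complex I in
  let xE : {mpoly K[n]} -> Prop := ideal_gen (fun g => g = sqfree K E) in
  (free_face Gamma E ->
     (forall i j : nat, j <> d -> j <> d.+1 ->
        betti (ideal_add I xE) i (i + j) = betti I i (i + j)) /\
     (forall a : nat, 2 < a ->
        (forall W : {set 'I_n}, #|W| = a -> ~ facet (restr Gamma W) E) ->
        forall i j : nat, 2 < j -> i + j = a ->
          betti (ideal_add I xE) i (i + j) = betti I i (i + j)))
  /\
  (1 <= d ->
   free_face Gamma E \/ free_face (d_closure d Gamma) E ->
   (forall m : 'X_{1..n}, min_mono_gen I m -> mdeg m <= d.+1) ->
   forall A : {set 'I_n}, A \subset ~: E ->
     (forall m : 'I_n, m \in A -> m |: E \in Gamma) ->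
     let xAE : {mpoly K[n]} -> Prop :=
       ideal_gen (fun g => exists2 m : 'I_n, m \in A & g = ('X_m * sqfree K E)%R) in
     (forall i j : nat, j <> d.+1 ->
        betti (ideal_add I xAE) i (i + j) = betti I i (i + j)) /\
     ((forall m : 'X_{1..n}, min_mono_gen I m -> mdeg m = d.+1) ->
      forall a : nat, 2 < a ->
        (forall W : {set 'I_n}, #|W| = a ->
           ~ facet (restr (SR_complex (ideal_add I xAE)) W) E) ->
        forall i j : nat, 2 < j -> i + j = a ->
          betti (ideal_add I xE) i (i + j) = betti (ideal_add I xAE) i (i + j) /\
          betti (ideal_add I xAE) i (i + j) = betti I i (i + j))).
Proof.
have [IG dG] := sqfree_monomial_idealE hI.
move=> Gamma xE; rewrite -/Gamma in IG dG.
have -> : ideal_add I xE = SR_ideal (deletion Gamma E).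
  by rewrite IG ideal_add_sqfree.
split=> [/(free_face_star dG)[H star]|_ free gens A AE AG xAE].
  split=> [i j jd jd1|a _ nf i j _ ija]; rewrite IG.
    by apply: (betti_deletion_strand K i dG star); rewrite hE.
  by rewrite ija; exact: (betti_deletion_no_facet K dG star nf).
have -> : ideal_add I xAE = SR_ideal (delete_stars Gamma E A).
  by rewrite IG /xAE ideal_add_sqfreeX.
rewrite IG SR_complex_ideal; rewrite IG in gens.
(* From here on the two kinds of freeness need not be distinguished. *)
have starG : E \in Gamma -> exists H, star_is_simplex Gamma E H.
  move=> EG; case: free => [/(free_face_star dG)//|].
  move/(free_face_star (@downclosed_d_closure _ _ _))=> [H star].
  by exists H; apply: (star_d_closure dG gens hE EG star).
have dA := @downclosed_delete_stars _ Gamma E A dG.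
have subA : delete_stars Gamma E A \subset Gamma.
  by apply/subsetP => F; rewrite inE => /andP[].
split=> [i j jd1|gens1 a _ nf i j _ ija].
  (* A member of A is what shows that E is a face of Gamma. *)
  have [A0|[m mA]] := set_0Vmem A.
    suff -> : delete_stars Gamma E A = Gamma by [].
    apply/setP => F; rewrite inE A0; case: (F \in Gamma) => //=.
    by apply/forallP => m; rewrite inE.
  have [H star] := starG (dG _ _ (subsetUr [set m] E) (AG m mA)).
  have [jd|dj] := leqP j d.
    apply: (betti_low_strand K i dA subA _ jd) => F FG; rewrite inE FG /=.
    rewrite negb_forall => /existsP[l]; rewrite negb_imply negbK => /andP[lA lF].
    apply: leq_trans (subset_leq_card lF).
    by have := subsetP AE l lA; rewrite inE => lE; rewrite cardsU1 lE hE.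
  have starA := star_delete_stars AE star.
  rewrite -(betti_deletion_strand K i dA starA) ?hE //.
    rewrite deletion_delete_stars.
    by apply: (betti_deletion_strand K i dG star); rewrite ?hE // => jd;
       rewrite jd ltnn in dj.
  by move=> jd; rewrite jd ltnn in dj.
(* A generator dividing x_E would have degree at most d. *)
have EG : E \in Gamma.
  apply: contraT => EG.
  have [|m mE mg] := @min_mono_gen_exists K n (SR_ideal Gamma) (mesym1 E).
    by apply/SR_idealX; rewrite msuppset_mesym1.
  have := mdegB (mesym1 E) (mesym1 E - m)%MM.
  have mEE : (mesym1 E - (mesym1 E - m))%MM = m.
    by apply/mnmP => l; rewrite !mnmBE subKn //; apply/mnm_lepP.
  by rewrite mEE mdeg_mesym1 gens1 // hE ltnn.
have [H star] := starG EG; have starA := star_delete_stars AE star.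
have eqA := betti_deletion_no_facet K dA starA nf i.
rewrite ija -eqA deletion_delete_stars; split=> //.
apply: (betti_deletion_no_facet K dG star) => // W Wa /maxsetP[EW maxE].
have [EHA /(_ E (subxx E)) EdA] := starA; rewrite EHA in EdA.
have {}EW : E \subset W by move: EW; rewrite /= in_set => /andP[].
apply: (nf W Wa); apply/maxsetP; split=> [|F]; rewrite /= in_set ?EdA //.
by move=> /andP[FA FW]; apply: maxE; rewrite /= in_set (subsetP subA).
Qed.
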